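(* Every S4 De Morgan algebra $A$ is isomorphic to $\mathcal{A}_0(\mathcal{S}_0(A))$, the algebra of compact open subsets of the prime spectrum of $A$.
   Context: A De Morgan algebra is a bounded distributive lattice $\langle A;\wedge,\vee,0,1\rangle$ with a unary operation $-$ such that $a\leq b$ implies $-b\leq -a$, and $--a=a$. An S4 De Morgan algebra is a De Morgan algebra with a unary operation $\nabla$ such that $\nabla(a\vee b)=\nabla a\vee\nabla b$, $\nabla 0=0$, $a\leq\nabla a$, and $\nabla\nabla a\leq\nabla a$. Isomorphisms are with respect to $\wedge,\vee,-,0,1,\nabla$. The prime spectrum of $A$ is $\mathcal{S}_0(A)=\langle\mathfrak{P}(A);g_A,R_A,\tau(\beta)\rangle$, where $\mathfrak{P}(A)$ is the set of prime (in particular proper) filters of $A$; $g_A(x)=\{a\in A:-a\notin x\}$; $xR_Ay$ iff for all $a\in A$, $a\in x$ implies $\nabla a\in y$; and $\tau(\beta)$ is the topology with basis $\beta=\{\phi(a):a\in A\}$, $\phi(a)=\{x\in\mathfrak{P}(A):a\in x\}$. For a topological space $X$ with a function $g\colon X\to X$ and a relation $R\subseteq X\times X$, $\Omega(X)$ is the set of compact open subsets of $X$, and $\mathcal{A}_0(X)=\langle\Omega(X);\cap,\cup,{}^*,\emptyset,X,\nabla_R\rangle$, where $U^*=\{x\in X:g(x)\notin U\}$ and $\nabla_RU=R[U]=\{y\in X:\exists x\in U,\ xRy\}$. *)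

(* Defs.v *)
From HB Require Import structures.
From mathcomp Require Import all_boot all_order.
From mathcomp Require Import boolp classical_sets functions topology.

Set Implicit Arguments.
Unset Strict Implicit.
Unset Printing Implicit Defensive.

Import Order.TTheory.

Local Open Scope classical_set_scope.
Local Open Scope order_scope.

HB.mixin Record isDeMorgan (d : Order.disp_t) A & Order.TBDistrLattice d A := {
  neg : A -> A;
  neg_anti : forall a b : A, a <= b -> neg b <= neg a;
  negK : forall a : A, neg (neg a) = a
}.

#[short(type="deMorganType")]
HB.structure Definition DeMorgan (d : Order.disp_t) :=
  {A of isDeMorgan d A & Order.TBDistrLattice d A}.

HB.mixin Record isS4DeMorgan (d : Order.disp_t) A & DeMorgan d A := {
  nabla : A -> A;
  nablaU : forall a b : A, nabla (a `|` b) = nabla a `|` nabla b;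
  nabla0 : nabla \bot = \bot;
  nabla_ge : forall a : A, a <= nabla a;
  nabla_nabla : forall a : A, nabla (nabla a) <= nabla a
}.

#[short(type="s4DeMorganType")]
HB.structure Definition S4DeMorgan (d : Order.disp_t) :=
  {A of isS4DeMorgan d A & DeMorgan d A}.

(* No axioms are imposed: a bijective morphism onto such a structure transports
   the S4 De Morgan identities to it. *)
Record algebra := Algebra {
  carrier :> Type;
  ameet : carrier -> carrier -> carrier;
  ajoin : carrier -> carrier -> carrier;
  aneg : carrier -> carrier;
  abot : carrier;
  atop : carrier;
  anabla : carrier -> carrier
}.

Definition algebra_of (d : Order.disp_t) (A : s4DeMorganType d) : algebra :=
  {| carrier := A;
     ameet := Order.meet;
     ajoin := Order.join;
     aneg := neg;
     abot := \bot;
     atop := \top;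
     anabla := nabla |}.

Record is_morphism (A B : algebra) (f : A -> B) : Prop := IsMorphism {
  morph_meet : {morph f : a b / ameet a b};
  morph_join : {morph f : a b / ajoin a b};
  morph_neg : {morph f : a / aneg a};
  morph_bot : f (abot A) = abot B;
  morph_top : f (atop A) = atop B;
  morph_nabla : {morph f : a / anabla a}
}.

Definition isomorphic (A B : algebra) : Prop :=
  exists2 f : A -> B, bijective f & is_morphism f.

HB.mixin Record hasMapRel (X : Type) := {
  spmap : X -> X;
  sprel : X -> X -> Prop
}.

#[short(type="mapRelSpaceType")]
HB.structure Definition MapRelSpace := {X of Topological X & hasMapRel X}.

Section CompactOpens.
Local Open Scope classical_set_scope.
Variable X : mapRelSpaceType.
Implicit Types U V : set X.

(* The filter-based [compact] agrees with the open cover definition for all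
   topological spaces, Hausdorff or not. *)
Definition Omega : set (set X) := [set U | compact U /\ open U].

Definition star U : set X := [set x | ~ U (spmap x)].

Definition nablaR U : set X := [set y | exists2 x, U x & sprel x y].

(* For an arbitrary X, Omega need not be stable under the operations of A0
   (e.g. X may fail to be compact), so stability is a prerequisite of A0. *)
Record Omega_closed : Prop := OmegaClosed {
  Omega_setI : forall U V, Omega U -> Omega V -> Omega (U `&` V);
  Omega_setU : forall U V, Omega U -> Omega V -> Omega (U `|` V);
  Omega_star : forall U, Omega U -> Omega (star U);
  Omega_set0 : Omega set0;
  Omega_setT : Omega setT;
  Omega_nablaR : forall U, Omega U -> Omega (nablaR U)
}.

Definition A0 (cl : Omega_closed) : algebra :=
  {| carrier := {U : set X | Omega U};
     ameet := fun K L => exist _ _ (Omega_setI cl (svalP K) (svalP L));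
     ajoin := fun K L => exist _ _ (Omega_setU cl (svalP K) (svalP L));
     aneg := fun K => exist _ _ (Omega_star cl (svalP K));
     abot := exist _ _ (Omega_set0 cl);
     atop := exist _ _ (Omega_setT cl);
     anabla := fun K => exist _ _ (Omega_nablaR cl (svalP K)) |}.

End CompactOpens.

Record is_prime_filter (d : Order.disp_t) (A : tbDistrLatticeType d)
    (F : set A) : Prop := IsPrimeFilter {
  pf_nonempty : F !=set0;
  pf_up : forall a b, a <= b -> F a -> F b;
  pf_meet : forall a b, F a -> F b -> F (a `&` b);
  pf_proper : F <> setT;
  pf_prime : forall a b, F (a `|` b) -> F a \/ F b
}.

Section Spectrum.
Variables (d : Order.disp_t) (A : s4DeMorganType d).

Record S0 := MkS0 {
  pf_set :> A -> Prop;
  pf_setP : is_prime_filter pf_set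
}.

HB.instance Definition _ := gen_eqMixin S0.
HB.instance Definition _ := gen_choiceMixin S0.

Definition phi (a : A) : set S0 := [set x : S0 | x a].

Definition beta : set (set S0) := range phi.

Lemma pf_top (x : S0) : x \top.
Proof.
by have [[a xa] up _ _ _] := pf_setP x; apply: up xa; exact: lex1.
Qed.

Lemma pf_bot (x : S0) : ~ x \bot.
Proof.
have [_ up _ xT _] := pf_setP x => x0; apply: xT.
by apply/seteqP; split=> // a _; apply: up x0; exact: le0x.
Qed.

Lemma beta_cover : \bigcup_(U in beta) U = setT.
Proof.
apply/seteqP; split=> // x _; exists (phi \top); first by exists \top.
exact: pf_top.
Qed.

Lemma beta_join (U V : set S0) (x : S0) : beta U -> beta V -> U x -> V x ->
  exists W, [/\ beta W, W x & (W `<=` U `&` V)%classic].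
Proof.
move=> [a _ <-] [b _ <-] xa xb; exists (phi (a `&` b)); split.
- by exists (a `&` b).
- by have [_ _ meet _ _] := pf_setP x; exact: meet.
- move=> y yab; have [_ up _ _ _] := pf_setP y.
  by split; apply: up yab; [exact: leIl|exact: leIr].
Qed.

HB.instance Definition _ :=
  isBaseTopological.Build S0 beta_cover beta_join.

Definition gA_set (x : S0) : set A := [set a | ~ x (neg a)].

Lemma gA_prime (x : S0) : is_prime_filter (gA_set x).
Proof.
have [_ up meet _ prime] := pf_setP x.
have neg1 : neg \top = \bot :> A.
  by apply/eqP; rewrite -lex0 -[X in _ <= X]negK; apply/neg_anti/lex1.
have neg0 : neg \bot = \top :> A by rewrite -neg1 negK.
split.
- by exists \top; rewrite /gA_set /= neg1; exact: pf_bot.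
- by move=> a b ab xa xb; apply: xa; apply: up xb; exact: neg_anti.
- move=> a b xa xb xab.
  have : x (neg a `|` neg b).
    apply: up xab; rewrite -[X in _ <= X]negK; apply: neg_anti.
    rewrite lexI -[X in _ <= X]negK -[X in _ && (_ <= X)]negK.
    by rewrite !neg_anti ?leUl ?leUr.
  by case/prime.
- move=> /seteqP[_ /(_ \bot I)]; rewrite /gA_set /= neg0.
  by apply; exact: pf_top.
- move=> a b xab; apply: contrapT => /not_orP[/contrapT xa /contrapT xb].
  apply: xab; apply: up (meet _ _ xa xb).
  rewrite -[X in X <= _]negK; apply: neg_anti.
  rewrite leUx -[X in X <= _]negK -[X in _ && (X <= _)]negK.
  by rewrite !neg_anti ?leIl ?leIr.
Qed.

Definition gA (x : S0) : S0 := MkS0 (gA_prime x).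

Definition RA (x y : S0) : Prop := forall a : A, x a -> y (nabla a).

HB.instance Definition _ := hasMapRel.Build S0 gA RA.

End Spectrum.

(* Main.v *)
(** The map [phi] is a lattice morphism by the definition of prime filters, and
    it commutes with negation by the choice of [gA]. Everything else follows
    from the prime filter theorem: whenever an element [a] lies outside an ideal
    [J], some prime filter contains [a] and avoids [J]. Taking for [J] the
    principal ideal of [b] gives injectivity; taking [b |-> nabla b \notin y]
    gives [phi (nabla a) = R[phi a]]; taking the ideal of all [b] such that the
    complement of [phi b] belongs to a given topological filter produces a
    cluster point of that filter, whence compactness of [phi a]. *)
Require Import Defs.
From mathcomp Require Import all_boot all_order.
From mathcomp Require Import boolp classical_sets functions topology.

Set Implicit Arguments.
Unset Strict Implicit.
Unset Printing Implicit Defensive.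

Import Order.TTheory.

Local Open Scope classical_set_scope.
Local Open Scope order_scope.

(** * Prime filters as complements of maximal ideals *)

Section PrimeFilterTheorem.
Variables (d : Order.disp_t) (L : tbDistrLatticeType d).
Implicit Types (a b c : L) (J : set L).

Record is_ideal J : Prop := IsIdeal {
  ideal_bot : J \bot;
  ideal_down : forall a b, a <= b -> J b -> J a;
  ideal_join : forall a b, J a -> J b -> J (a `|` b)
}.

Lemma principal_ideal b : is_ideal [set c | c <= b].
Proof.
split=> /=; first exact: le0x.
- by move=> a c; exact: le_trans.
- by move=> a c ab cb; rewrite leUx ab.
Qed.

(** This is the ideal generated by [J] and [b], to be played against maximality. *)
Lemma ideal_adjoin J b : is_ideal J ->
  is_ideal [set c | exists2 i, J i & c <= i `|` b].
Proof.
case=> J0 Jdown JU; split=> /=.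
- by exists \bot => //; exact: le0x.
- by move=> a c ac [i Ji ci]; exists i => //; exact: le_trans ci.
- move=> a c [i Ji ai] [j Jj cj]; exists (i `|` j); first exact: JU.
  by rewrite -(joinxx b) joinACA leU2.
Qed.

Lemma maximal_ideal_avoiding J a : is_ideal J -> ~ J a ->
  exists I : set L, [/\ is_ideal I, (J `<=` I)%classic, ~ I a &
    forall K, is_ideal K -> (I `<=` K)%classic -> ~ K a -> K = I].
Proof.
move=> idJ Ja.
(* Uniting with [J] keeps the empty chain from being a special case. *)
pose P X := is_ideal (J `|` X)%classic /\ ~ (J `|` X)%classic a.
have [F FP Ftot|X [[idX Xa] Xmax]] := @Zorn_bigcup _ P.
  split; last first.
    by case=> // -[X FX Xa]; have [_] := FP _ FX; apply; right.
  have [J0 Jdown JU] := idJ; split; first by left.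
    move=> b c bc [Jc|[X FX Xc]]; first by left; exact: Jdown Jc.
    have [[_ down _] _] := FP _ FX.
    by case: (down _ _ bc (or_intror Xc)); [left|right; exists X].
  (* In a chain, two elements always lie in a common member, the larger of the two. *)
  have join X b c : F X -> (J `|` X)%classic b -> (J `|` X)%classic c ->
      (J `|` \bigcup_(Y in F) Y)%classic (b `|` c).
    move=> FX bX cX; have [[_ _ XU] _] := FP _ FX.
    by case: (XU _ _ bX cX); [left|right; exists X].
  move=> b c [Jb|[X FX Xb]] [Jc|[Y FY Yc]].
  - by left; exact: JU.
  - by apply: (join Y) => //; [left|right].
  - by apply: (join X) => //; [right|left].
  - case: (Ftot _ _ FX FY) => [XY|YX].
    + by apply: (join Y) => //; right => //; exact: XY.
    + by apply: (join X) => //; right => //; exact: YX.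
exists (J `|` X)%classic; split => // K idK; rewrite subUset => -[JK XK] Ka.
have PK : P K by rewrite /P (setUidr JK).
have [KX|KX] := pselect (K `<=` X)%classic.
  by apply/seteqP; split=> [b Kb|b [/JK|/XK]//]; right; exact: KX.
by case: (Xmax K).
Qed.

(** By maximality, adjoining to [I] any [b] outside it captures [a]. For two such elements,
    distributivity bounds [a] by their meet joined with a member of [I], so that meet is outside [I]
    too. *)
Lemma maximal_ideal_prime (I : set L) a : is_ideal I -> ~ I a ->
  (forall K, is_ideal K -> (I `<=` K)%classic -> ~ K a -> K = I) ->
  is_prime_filter (~` I).
Proof.
move=> idI Ia Imax; have [I0 Idown IU] := idI.
have adjoin b : ~ I b -> exists2 i, I i & a <= i `|` b.
  move=> Ib; apply: contrapT => Ka; apply: Ib.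
  rewrite -(Imax _ (ideal_adjoin b idI) _ Ka) /=.
    by exists \bot => //; exact: leUr.
  by move=> c Ic; exists c => //; exact: leUl.
split.
- by exists a.
- by move=> b c bc Ib /(Idown _ _ bc).
- move=> b c /adjoin[i Ii ai] /adjoin[j Ij aj] Ibc; apply: Ia.
  apply: (Idown _ ((i `|` j) `|` (b `&` c))); last by apply/IU/Ibc/IU.
  rewrite joinIr lexI; apply/andP; split.
    by rewrite (le_trans ai)// leU2// leUl.
  by rewrite (le_trans aj)// leU2// leUr.
- by move=> /seteqP[_ /(_ \bot Logic.I)].
- by move=> b c Ibc; apply/not_andP => -[Ib Ic]; exact/Ibc/IU.
Qed.

Theorem prime_filter_theorem J a : is_ideal J -> ~ J a ->
  exists F : set L, [/\ is_prime_filter F, F a & forall b, J b -> ~ F b].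
Proof.
move=> idJ /(maximal_ideal_avoiding idJ)[I [idI JI Ia Imax]].
exists (~` I)%classic; split=> //; first exact: maximal_ideal_prime idI Ia Imax.
by move=> b /JI Ib; apply.
Qed.

End PrimeFilterTheorem.

(** * The representation map [phi] and the operations *)

Section Representation.
Variables (d : Order.disp_t) (A : s4DeMorganType d).
Implicit Types (a b c : A) (x y : S0 A).

Lemma prime_point (J : set A) a : is_ideal J -> ~ J a ->
  exists2 x : S0 A, x a & forall b, J b -> ~ x b.
Proof.
by move=> idJ /(prime_filter_theorem idJ)[F [pF Fa JF]]; exists (MkS0 pF).
Qed.

Lemma phi_le a b : (phi a `<=` phi b)%classic -> a <= b.
Proof.
move=> ab; apply: contrapT => nab.
have [x xa xb] := prime_point (principal_ideal b) nab.
by apply: (xb b) => /=; [exact: lexx|exact: ab].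
Qed.

Lemma phi_inj : injective (@phi _ A).
Proof. by move=> a b ab; apply/le_anti; rewrite !phi_le// ab. Qed.

Lemma phiI a b : phi (a `&` b) = (phi a `&` phi b)%classic.
Proof.
apply/seteqP; split=> x /=; have [_ up meet _ _] := pf_setP x.
- by move=> xab; split; apply: up xab; [exact: leIl|exact: leIr].
- by case; exact: meet.
Qed.

Lemma phiU a b : phi (a `|` b) = (phi a `|` phi b)%classic.
Proof.
apply/seteqP; split=> x /=; have [_ up _ _ prime] := pf_setP x.
- exact: prime.
- by case; apply: up; [exact: leUl|exact: leUr].
Qed.

Lemma phi0 : phi (\bot : A) = set0.
Proof. by apply/seteqP; split=> x // /pf_bot. Qed.

Lemma phi1 : phi (\top : A) = setT.
Proof. by apply/seteqP; split=> x // _; exact: pf_top. Qed.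

(** Unfolding [gA] turns membership of [x] in the right-hand side into [~ ~ x (neg a)]. *)
Lemma phi_neg a : phi (neg a) = star (phi a).
Proof.
apply/seteqP; split=> x; rewrite /star /phi /= /gA_set /=.
- by move=> xa; apply.
- by move/contrapT.
Qed.

Lemma nabla_homo a b : a <= b -> nabla a <= nabla b.
Proof. by rewrite !leEjoin -nablaU => /eqP->. Qed.

Lemma phi_nabla a : phi (nabla a) = nablaR (phi a).
Proof.
apply/seteqP; split=> y; last by case=> x xa; exact.
move=> ya; have [_ up _ _ prime] := pf_setP y.
have idJ : is_ideal [set b | ~ y (nabla b)].
  split=> /=.
  - by rewrite nabla0; exact: pf_bot.
  - by move=> b c bc yc yb; apply: yc; apply: up yb; exact: nabla_homo.
  - by move=> b c yb yc; rewrite nablaU => /prime[].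
(* That [x] avoids this ideal is [RA x y], up to a double negation. *)
have [x xa xJ] := prime_point idJ (fun k => k ya).
by exists x => // b xb; apply: contrapT => /xJ; exact.
Qed.

(** * Compact open sets of the spectrum *)

Lemma openS0P (U : set (S0 A)) :
  open U <-> forall x, U x -> exists2 b, x b & (phi b `<=` U)%classic.
Proof.
split=> [[D Dbeta <-] x [V DV Vx]|Ubase].
  have [b _ bV] := Dbeta _ DV; exists b; first by rewrite -bV in Vx.
  by rewrite bV => y Vy; exists V.
exists [set V | beta V /\ (V `<=` U)%classic]; first by move=> V [].
apply/seteqP; split=> [x [V [_ VU] /VU//]|x Ux].
by have [b xb bU] := Ubase x Ux; exists (phi b) => //; split=> //; exists b.
Qed.

Lemma open_phi a : open (phi a).
Proof. by apply/openS0P => x xa; exists a. Qed.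

Lemma compact_phi a : compact (phi a).
Proof.
move=> F FF Fa.
have idJ : is_ideal [set b | F (~` phi b)%classic].
  split=> /=.
  - by rewrite phi0 setC0; exact: filterT.
  - move=> b c bc; apply: filterS => x xc xb; apply: xc.
    by have [_ up _ _ _] := pf_setP x; exact: up xb.
  - by move=> b c Fb Fc; rewrite phiU setCU; exact: filterI.
have nJa : ~ F (~` phi a)%classic.
  by move=> /(filterI Fa); rewrite setICr; exact: filter_not_empty.
have [x xa xJ] := prime_point idJ nJa.
exists x; split=> // V W FV; rewrite nbhsE => -[O [Oopen Ox] OW].
have [b xb bO] := (openS0P O).1 Oopen x Ox.
(* If [V] missed [W], it would miss [phi b], so the complement of [phi b] would be in [F] and [b] in
   the ideal that [x] avoids. *)
apply: contrapT => VW; apply: (xJ b) => //=; apply: filterS FV => y Vy yb.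
by apply: VW; exists y; split=> //; apply/OW/bO.
Qed.

Lemma Omega_phi a : Omega (phi a).
Proof. by split; [exact: compact_phi|exact: open_phi]. Qed.

(* Otherwise the sets [U `\` phi b] with [phi b `<=` U] would generate a proper
   filter without cluster point in [U]. *)
Lemma Omega_phi_surj (U : set (S0 A)) : Omega U -> exists a, phi a = U.
Proof.
move=> [Ucompact /openS0P Ubase]; apply: contrapT => Uphi.
pose B := [set b | (phi b `<=` U)%classic].
pose F := filter_from B (fun b => U `\` phi b)%classic.
have FF : ProperFilter F.
  apply: filter_from_proper; last first.
    move=> b bU; apply: contrapT => Ub; apply: Uphi; exists b.
    apply/seteqP; split=> // x Ux; apply: contrapT => xb.
    by apply: Ub; exists x.
  apply: filter_from_filter.
    by exists \bot; rewrite /B /= phi0; exact: sub0set.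
  move=> b c bU cU; exists (b `|` c); first by rewrite /B /= phiU subUset.
  by rewrite phiU setDUr.
have [|x [Ux xF]] := Ucompact F FF.
  by exists \bot; rewrite /B /= phi0; [exact: sub0set|exact: subDsetl].
have [b xb bU] := Ubase x Ux.
(* The cluster point [x] has the neighbourhood [phi b], disjoint from a member of [F]. *)
have [] := xF (U `\` phi b)%classic (phi b).
- by exists b.
- by apply: open_nbhs_nbhs; split=> //; exact: open_phi.
- by move=> y [[_ ]].
Qed.

(** Every compact open set is some [phi a], so stability follows from [phi] commuting with the
    operations. *)
Lemma Omega_closed_S0 : Omega_closed (S0 A).
Proof.
split.
- move=> _ _ /Omega_phi_surj[a <-] /Omega_phi_surj[b <-].
  by rewrite -phiI; exact: Omega_phi.
- move=> _ _ /Omega_phi_surj[a <-] /Omega_phi_surj[b <-].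
  by rewrite -phiU; exact: Omega_phi.
- by move=> _ /Omega_phi_surj[a <-]; rewrite -phi_neg; exact: Omega_phi.
- by rewrite -phi0; exact: Omega_phi.
- by rewrite -phi1; exact: Omega_phi.
- by move=> _ /Omega_phi_surj[a <-]; rewrite -phi_nabla; exact: Omega_phi.
Qed.

End Representation.

Theorem theorem3p13 (d : Order.disp_t) (A : s4DeMorganType d) :
  exists cl : Omega_closed (S0 A), isomorphic (algebra_of A) (A0 cl).
Proof.
exists (Omega_closed_S0 A).
exists (fun a : A => exist _ (phi a) (Omega_phi a)).
  have surj (K : {U : set (S0 A) | Omega U}) : exists a : A, phi a = sval K.
    exact: Omega_phi_surj (svalP K).
  (* Choosing preimages gives the inverse; injectivity makes it two-sided. *)
  have [g phig] := choice surj.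
  exists g => [a|[U OU]]; first by apply: phi_inj; rewrite phig.
  by apply: eq_exist; rewrite phig.
split; rewrite /=.
- by move=> a b; apply: eq_exist; exact: phiI.
- by move=> a b; apply: eq_exist; exact: phiU.
- by move=> a; apply: eq_exist; exact: phi_neg.
- by apply: eq_exist; exact: phi0.
- by apply: eq_exist; exact: phi1.
- by move=> a; apply: eq_exist; exact: phi_nabla.
Qed.
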